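(* For every integer $l\geqslant 2$ there exist real numbers $\epsilon=\epsilon(l)>0$ and $s_0=s_0(l)>0$ such that the following holds. Let $G=K_{s,t}$ be an edge-colored complete bipartite graph on $X\sqcup Y$ with $|X|=s$, $|Y|=t$, $s>s_0$ and $s/\log s<t\leqslant s$. Then at least one of the following holds: (1) $G$ contains a rainbow colored $K_{4l,4l}$; (2) there are vertex sets $Q, R$ with $|Q|=q=s^{\epsilon}$, $|R|=2l$, and either $Q\subset X, R\subset Y$ or $Q\subset Y, R\subset X$, such that the complete bipartite subgraph of $G$ between $Q$ and $R$ is $Q$-canonical; (3) there are vertex sets $Q, R$ with $|Q|=q=s^{\epsilon}$, $|R|=2l$, and either $Q\subset X, R\subset Y$ or $Q\subset Y, R\subset X$, such that the complete bipartite subgraph of $G$ between $Q$ and $R$ is monochromatic.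
   Context: Edge colors are arbitrary. A subgraph is rainbow colored if its edges have pairwise distinct colors. For an edge-colored bipartite graph with parts $Q\sqcup R$: it is monochromatic if all edges have the same color; it is $Q$-canonical if for each $x\in Q$ all edges from $x$ to $R$ have a common color $z_x$, and the colors $z_x$, $x\in Q$, are pairwise distinct. Logarithms are base 2; the paper omits floors and ceilings, so $s^\epsilon$ is understood as rounded to an integer. *)

(* Defs.v *)
From mathcomp Require Import all_boot all_order all_algebra.
From mathcomp Require Import reals exp.

Set Implicit Arguments.
Unset Strict Implicit.
Unset Printing Implicit Defensive.

Import Order.TTheory GRing.Theory Num.Theory.
Local Open Scope ring_scope.

Definition log2 (K : realType) (x : K) : K := ln x / ln 2.

(* An edge colouring of the complete bipartite graph on X \sqcup Y is a
   function c : X -> Y -> C into an arbitrary type of colours; the colouring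
   with the two parts exchanged is [fun y x => c x y]. *)
Section Colorings.
Variables (X Y : finType) (C : Type) (c : X -> Y -> C).
Implicit Types (Q : {set X}) (R : {set Y}).

Definition rainbow Q R : Prop :=
  {in setX Q R &, injective (fun e : X * Y => c e.1 e.2)}.

Definition monochromatic Q R : Prop :=
  {in setX Q R &, forall e f : X * Y, c e.1 e.2 = c f.1 f.2}.

(* Q-canonical: the first argument is the distinguished side. *)
Definition canonical_coloring Q R : Prop :=
  exists z : X -> C,
    {in Q & R, forall x y, c x y = z x} /\ {in Q &, injective z}.

End Colorings.

(* Main.v *)
(* Write r = 2l, n = 4l and eps = 1/4. If r vertices of Y see at least q^2
   vertices x whose r edges to them have one colour, pigeonhole on that colour
   gives a monochromatic or canonical K_{q,r}. Otherwise, double counting pairs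
   (x, r-subset of a colour class of x) shows that only a 1/m fraction of the
   vertices x have a colour class larger than about t/m, for a constant m. Hence
   two edges of the same colour are rare, whether or not they share a vertex,
   and by the union bound uniformly random maps f : 'I_n -> X, g : 'I_n -> Y
   span a rainbow K_{n,n}; distinct colours force f and g to be injective. *)
Require Import Defs.
From mathcomp Require Import all_boot all_order all_algebra.
From mathcomp Require Import boolp reals exp.
From mathcomp Require Import zify lra ring.

Import Order.TTheory GRing.Theory Num.Theory.
Local Open Scope nat_scope.

(** * Pigeonhole on colours *)

Lemma subset_of_card {T : finType} (A : {set T}) k :
  k <= #|A| -> exists2 B : {set T}, B \subset A & #|B| = k.
Proof.
move=> kA; have : 0 < 'C(#|A|, k) by rewrite bin_gt0.
rewrite -cards_draws card_gt0 => /set0Pn[B]; rewrite inE => /andP[BA /eqP Bk].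
by exists B.
Qed.

(** The classes of equal [h]-value partition [A]. With at least [q] classes, one point from each
    will do; with fewer, some class has [q] points, since otherwise [#|A| <= (q - 1) ^ 2]. *)
Lemma fiber_or_transversal {T : finType} {C : eqType} (h : T -> C)
    (A : {set T}) q : 0 < q -> q ^ 2 <= #|A| ->
  exists Q : {set T}, [/\ Q \subset A, #|Q| = q &
    {in Q &, injective h} \/ {in Q &, forall x y, h x = h y}].
Proof.
move=> q_gt0 qA; pose P := preim_partition h A.
have PA : partition P A := preim_partitionP h A.
have pb x y : x \in A -> y \in A -> (y \in pblock P x) = (h x == h y).
  by apply: pblock_equivalence_partition => u v w _ _ _; split=> // /eqP->.
have [qP | Pq] := leqP q #|P|.
  have trP := transversalP PA.
  have [Q QT Qq] : exists2 Q : {set T}, Q \subset transversal P A & #|Q| = q.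
    by apply: subset_of_card; rewrite (card_transversal trP).
  have QA := subset_trans QT (transversal_sub trP).
  exists Q; split=> //; left=> x y xQ yQ hxy.
  apply: (pblock_inj trP); rewrite ?(subsetP QT) //.
  apply/esym/same_pblock; first by case/and3P: PA.
  by rewrite pb ?(subsetP QA) // hxy.
have [/existsP[B /andP[BP qB]] | /existsPn noB] :=
  boolP [exists B, (B \in P) && (q <= #|B|)].
  have [Q QB Qq] := subset_of_card _ _ qB.
  have BA : B \subset A.
    by rewrite -(cover_partition PA) /cover (bigcup_sup B).
  exists Q; split=> //; first exact: subset_trans QB BA.
  right=> x y xQ yQ; apply/eqP; rewrite -pb ?(subsetP BA) ?(subsetP QB) //.
  by rewrite (def_pblock _ BP) ?(subsetP QB) //; case/and3P: PA.
have : #|A| <= #|P| * q.-1.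
  rewrite (card_partition PA) -sum_nat_const; apply: leq_sum => B BP.
  by have := noB B; rewrite BP /=; lia.
nia.
Qed.

(** Boolean, so that such vertices can be counted; hence the [eqType] of colours. *)
Definition star_mono {X Y : finType} {C : eqType} (c : X -> Y -> C)
    (x : X) (R : {set Y}) : bool :=
  [forall y in R, forall y' in R, c x y == c x y'].

Lemma star_monoP {X Y : finType} {C : eqType} (c : X -> Y -> C) x
    (R : {set Y}) :
  reflect {in R &, forall y y', c x y = c x y'} (star_mono c x R).
Proof.
apply: (iffP forall_inP) => [H y y' yR y'R | H y yR].
  by have /forall_inP/(_ _ y'R)/eqP := H y yR.
by apply/forall_inP => y' y'R; apply/eqP/H.
Qed.

(** A one-coloured star is determined by its colour towards a fixed [y0] in [R]. Among these
    colours, distinct ones give the canonical case, equal ones the monochromatic case. *)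
Lemma canonical_or_monochromatic {X Y : finType} {C : eqType}
    (c : X -> Y -> C) q (R : {set Y}) :
  0 < q -> 0 < #|R| -> q ^ 2 <= #|[set x | star_mono c x R]| ->
  exists Q : {set X},
    #|Q| = q /\ (canonical_coloring c Q R \/ monochromatic c Q R).
Proof.
move=> q_gt0; rewrite card_gt0 => /set0Pn[y0 y0R] qA.
have [Q [QA Qq hQ]] := fiber_or_transversal (c^~ y0) _ _ q_gt0 qA.
have cQ x y : x \in Q -> y \in R -> c x y = c x y0.
  by move/(subsetP QA); rewrite inE => /star_monoP H yR; apply: H.
exists Q; split=> //; case: hQ => hQ; [left|right].
  by exists (c^~ y0); split.
move=> [x y] [x' y'] /setXP[/= xQ yR] /setXP[/= x'Q y'R].
by rewrite !cQ //; apply: hQ.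
Qed.

(** * Heavy vertices and counts of equally coloured edges *)

Lemma leq_expn_ffact E r : E ^ r <= (E + r) ^_ r.
Proof.
have -> : E ^ r = \prod_(i < r) E by rewrite prod_nat_const card_ord.
rewrite ffact_prod.
by apply: leq_prod => i _; have := ltn_ord i; lia.
Qed.

Lemma ffact_leq_expn t r : t ^_ r <= t ^ r.
Proof.
have -> : t ^ r = \prod_(i < r) t by rewrite prod_nat_const card_ord.
rewrite ffact_prod.
by apply: leq_prod => i _; exact: leq_subr.
Qed.

Lemma sum_mem {T : finType} (A : {set T}) : \sum_x (x \in A) = #|A|.
Proof.
by rewrite -sum1_card [RHS]big_mkcond; apply: eq_bigr => x _; case: (x \in A).
Qed.

Section ColorClasses.
Variables (X Y : finType) (C : eqType) (c : X -> Y -> C) (m q r s t : nat).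
Hypotheses (cardX : #|X| = s) (cardY : #|Y| = t).
Hypotheses (m_gt0 : 0 < m) (q_gt0 : 0 < q).
Hypothesis few_star_mono : forall R : {set Y},
  #|R| = r -> #|[set x | star_mono c x R]| <= q ^ 2.
Hypotheses (geX : m * (2 * m) ^ r * q ^ 2 <= s)
           (geY : m * (2 * m) ^ r * q ^ 2 <= t).

Definition color_class x a := [set y | c x y == a].
Definition heavy D := [set x | [exists y, D <= #|color_class x (c x y)|]].

(** Double count pairs of a heavy [x] and an [r]-set [R] with [star_mono c x R]. Each heavy [x] has
    at least ['C(D, r)] such sets inside a large colour class; each [R] serves at most [q ^ 2]
    vertices. *)
Lemma card_heavy D : #|heavy D| * 'C(D, r) <= 'C(t, r) * q ^ 2.
Proof.
pose S := [set R : {set Y} | #|R| == r].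
have cS : #|S| = 'C(t, r).
  rewrite -cardY -cardsT -cards_draws.
  by apply: eq_card => R; rewrite !inE subsetT.
have left_count : #|heavy D| * 'C(D, r)
    <= \sum_(x in heavy D) \sum_(R in S) star_mono c x R.
  rewrite -sum_nat_const; apply: leq_sum => x; rewrite inE => /existsP[y Dy].
  apply: (leq_trans (leq_bin2l _ Dy)); rewrite -cards_draws.
  rewrite -sum1_card big_mkcond [X in _ <= X]big_mkcond.
  apply: leq_sum => R _; rewrite !inE.
  case: (boolP (#|R| == r)); last by rewrite andbF.
  rewrite andbT; case: ifP => // RD _; rewrite lt0b.
  apply/star_monoP => u v /(subsetP RD) + /(subsetP RD).
  by rewrite !inE => /eqP-> /eqP->.
apply: leq_trans left_count _; rewrite exchange_big -cS -sum_nat_const /=.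
apply: leq_sum => R; rewrite inE => /eqP /few_star_mono; apply: leq_trans.
rewrite -sum1_card big_mkcond [X in _ <= X]big_mkcond; apply: leq_sum => x _.
by rewrite !inE; case: star_mono; case: ifP.
Qed.

(** For [D] slightly above [t / m], the ratio of ['C(t, r)] to ['C(D, r)] is at most [(2 * m) ^ r],
    so [card_heavy] leaves at most [(2 * m) ^ r * q ^ 2] heavy vertices. *)
Lemma few_heavy : exists (H : {set X}) (D : nat),
  [/\ m * #|H| <= s, m * D <= 2 * t &
      forall x a, x \notin H -> #|color_class x a| <= D].
Proof.
(* The extra [r] gives [E ^ r <= D ^_ r], so that powers can replace binomials. *)
pose E := t %/ m; pose D := E + r.
have r_le : r <= (2 * m) ^ r by apply/ltnW/ltn_expl; lia.
have rmt : r * m <= t.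
  apply: leq_trans geY; rewrite mulnC -mulnA leq_mul2l.
  by apply/orP; right; nia.
have pow_gt0 : 0 < (2 * m) ^ r by rewrite expn_gt0; lia.
have mt : m <= t.
  apply: leq_trans geY; rewrite -mulnA leq_pmulr // muln_gt0 pow_gt0.
  by rewrite expn_gt0 q_gt0.
have E_gt0 : 0 < E by rewrite divn_gt0.
(* Rounding down costs at most a factor 2: the remainder is below [m <= m * E]. *)
have tE : t <= 2 * m * E.
  by have := divn_eq t m; have := ltn_pmod t m_gt0; rewrite -/E; nia.
have Em : E * m <= t by exact: leq_divM.
exists (heavy D), D; split.
- have H1 : #|heavy D| * E ^ r <= t ^ r * q ^ 2.
    apply: (@leq_trans (#|heavy D| * D ^_ r)).
      by rewrite leq_mul2l leq_expn_ffact orbT.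
    apply: (@leq_trans (t ^_ r * q ^ 2)); last first.
      by rewrite leq_mul2r ffact_leq_expn orbT.
    have := leq_mul (card_heavy D) (leqnn r`!).
    by rewrite -mulnA bin_ffact mulnAC bin_ffact.
  have H2 : #|heavy D| <= (2 * m) ^ r * q ^ 2.
    rewrite -(@leq_pmul2r (E ^ r)) ?expn_gt0 ?E_gt0 //.
    apply: leq_trans H1 _; rewrite mulnAC -expnMn leq_mul2r.
    by apply/orP; right; case: (r) => // k; rewrite leq_exp2r.
  by apply: leq_trans geX; rewrite -mulnA leq_mul2l H2 orbT.
- by rewrite /D mulnDr; nia.
move=> x a; rewrite inE => /existsPn noy.
(* A colour absent at [x] has an empty class; any other is [c x y] for some [y], as in [heavy]. *)
have [-> | [y]] := set_0Vmem (color_class x a); first by rewrite cards0.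
by rewrite inE => /eqP <-; have := noy y; rewrite -ltnNge => /ltnW.
Qed.

(** Heavy vertices contribute at most [#|H| * t], the others at most [D] each; times [m], this is at
    most [s * t] plus [2 * s * t]. *)
Lemma color_rare a :
  m * (\sum_x \sum_y (a == c x y)) <= 3 * s * t.
Proof.
have [H [D [mH mD leD]]] := few_heavy.
have : \sum_x \sum_y (a == c x y) <= \sum_x (D + (x \in H) * t).
  apply: leq_sum => x _.
  have -> : \sum_y (a == c x y) = #|color_class x a|.
    rewrite -sum1_card [RHS]big_mkcond; apply: eq_bigr => y _.
    by rewrite inE eq_sym; case: eqP.
  case: (boolP (x \in H)) => [_ | /leD]; last by rewrite mul0n addn0.
  by rewrite mul1n (leq_trans (max_card _)) // cardY leq_addl.
rewrite big_split /= sum_nat_const cardX -big_distrl /= sum_mem.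
set S := \sum_x _ => leS; apply: (@leq_trans (m * (s * D + #|H| * t))).
  by rewrite leq_mul2l leS orbT.
have := leq_mul (leqnn s) mD; have := leq_mul mH (leqnn t).
by rewrite mulnDr; lia.
Qed.

(** The same split: a heavy [x] gives at most [t ^ 2]; for any other [x], each [y] leaves at most
    [D] choices of [y']. *)
Lemma star_collisions :
  m * (\sum_x \sum_y \sum_y' (c x y == c x y')) <= 3 * s * t ^ 2.
Proof.
have [H [D [mH mD leD]]] := few_heavy.
have : \sum_x \sum_y \sum_y' (c x y == c x y')
    <= \sum_x (t * D + (x \in H) * t ^ 2).
  apply: leq_sum => x _.
  have cl a : \sum_y (a == c x y) = #|color_class x a|.
    rewrite -sum1_card [RHS]big_mkcond; apply: eq_bigr => y _.
    by rewrite inE eq_sym; case: eqP.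
  under eq_bigr => y _ do rewrite cl.
  case: (boolP (x \in H)) => [_ | /leD leDx].
    rewrite mul1n (leq_trans _ (leq_addl _ _)) // -mulnn -[X in _ <= X * _]cardY -sum1_card.
    rewrite big_distrl /=; apply: leq_sum => y _.
    by rewrite mul1n -cardY max_card.
  rewrite mul0n addn0 -cardY -sum_nat_const; exact: leq_sum.
rewrite big_split /= sum_nat_const cardX -big_distrl /= sum_mem.
set S := \sum_x _ => leS.
apply: (@leq_trans (m * (s * (t * D) + #|H| * t ^ 2))).
  by rewrite leq_mul2l leS orbT.
have := leq_mul (leqnn (s * t)) mD.
have := leq_mul mH (leqnn (t ^ 2)).
by rewrite mulnDr -!mulnn; lia.
Qed.

(** Fix the first edge and apply [color_rare] to its colour. *)
Lemma edge_collisions :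
  m * (\sum_x \sum_x' \sum_y \sum_y' (c x y == c x' y'))
    <= 3 * s ^ 2 * t ^ 2.
Proof.
under eq_bigr => x _ do rewrite exchange_big /=.
rewrite big_distrr /=.
have -> : 3 * s ^ 2 * t ^ 2 = \sum_(x : X) \sum_(y : Y) 3 * s * t.
  by rewrite !sum_nat_const cardX cardY -!mulnn; lia.
apply: leq_sum => x _; rewrite big_distrr /=.
by apply: leq_sum => y _; exact: color_rare.
Qed.

End ColorClasses.

(** * Averaging over random maps, with denominators cleared to stay in [nat] *)

Lemma sum_ffun1 {I X : finType} (i : I) (F : X -> nat) :
  (\sum_(f : {ffun I -> X}) F (f i)) * #|X| = #|X| ^ #|I| * \sum_x F x.
Proof.
(* As a product over all indices with one nontrivial factor, the summand lets the sum over [f]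
   factorize. *)
pose G j x := if j == i then F x else 1.
have -> : \sum_(f : {ffun I -> X}) F (f i)
    = \sum_(f : {ffun I -> X}) \prod_j G j (f j).
  apply: eq_bigr => f _; rewrite (bigD1 i) //= /G eqxx big1 ?muln1 // => j.
  by move/negPf->.
rewrite -bigA_distr_bigA (bigD1 i) //= /G eqxx.
rewrite [\prod_(j | j != i) _](eq_bigr (fun=> #|X|)); last first.
  by move=> j /negPf->; rewrite sum1_card.
rewrite prod_nat_const cardC1 -mulnA -expnSr mulnC prednK //.
by apply/card_gt0P; exists i.
Qed.

(** Values at distinct indices are independent and uniform. By linearity it suffices to count the
    maps with both values prescribed, which is [card2]. *)
Lemma sum_ffun2 {I X : finType} (i i' : I) (F : X -> X -> nat) : i != i' ->
  (\sum_(f : {ffun I -> X}) F (f i) (f i')) * #|X| ^ 2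
    = #|X| ^ #|I| * \sum_x \sum_x' F x x'.
Proof.
move=> ii'; have i'i : (i' == i) = false by apply: negbTE; rewrite eq_sym.
have card2 u v : (\sum_(f : {ffun I -> X}) (f i == u) * (f i' == v))
    * #|X| ^ 2 = #|X| ^ #|I|.
  pose G j x := if j == i then (x == u) : nat else
                if j == i' then (x == v) : nat else 1.
  have -> : \sum_(f : {ffun I -> X}) (f i == u) * (f i' == v)
      = \sum_(f : {ffun I -> X}) \prod_j G j (f j).
    apply: eq_bigr => f _; rewrite (bigD1 i) //= (bigD1 i') ?i'i //= /G.
    rewrite !eqxx i'i big1 ?muln1 // => j.
    by case/andP=> /negPf-> /negPf->.
  have sum_eq (w : X) : \sum_x (x == w : nat) = 1.
    by rewrite -big_mkcond /= big_pred1_eq.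
  rewrite -bigA_distr_bigA (bigD1 i) //= (bigD1 i') ?i'i //= /G.
  rewrite !eqxx i'i !sum_eq !mul1n.
  rewrite (eq_bigr (fun=> #|X|)); last first.
    by move=> j /andP[/negPf-> /negPf->]; rewrite sum1_card.
  rewrite prod_nat_const -expnD.
  suff -> : #|[pred j | (j != i) && (j != i')]| + 2 = #|I| by [].
  rewrite -cardsT [in RHS](cardsD1 i) (cardsD1 i' ([set: I] :\ i)) !inE.
  rewrite i'i /= addnC addnA; congr (_ + _).
  by apply: eq_card => j; rewrite !inE andbT andbC.
have -> : \sum_(f : {ffun I -> X}) F (f i) (f i')
    = \sum_u \sum_v (\sum_(f : {ffun I -> X}) (f i == u) * (f i' == v)) * F u v.
  under [RHS]eq_bigr => u _ do under eq_bigr => v _ do rewrite big_distrl /=.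
  under [RHS]eq_bigr => u _ do rewrite exchange_big /=.
  rewrite [RHS]exchange_big /=; apply: eq_bigr => f _.
  rewrite (bigD1 (f i)) //= (bigD1 (f i')) //= !eqxx !mul1n.
  rewrite !big1 ?addn0 // => [u | v].
    by rewrite eq_sym => /negPf->; apply: big1 => v _.
  by rewrite eq_sym => /negPf->; rewrite muln0 mul0n.
rewrite !big_distrl big_distrr /=; apply: eq_bigr => u _.
rewrite !big_distrl big_distrr /=; apply: eq_bigr => v _.
by rewrite mulnAC card2.
Qed.

(** Averaging reduces the cases [i = i'], [j = j'] and neither to the three collision bounds in
    turn. The maps need not be injective, but those sums include coinciding vertices. *)
Lemma collision_rare {X Y : finType} {C : eqType} (c : X -> Y -> C) m n s t
    (i i' j j' : 'I_n) :
  #|X| = s -> #|Y| = t -> 0 < s -> 0 < t ->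
  m * (\sum_x \sum_y \sum_y' (c x y == c x y')) <= 3 * s * t ^ 2 ->
  m * (\sum_y \sum_x \sum_x' (c x y == c x' y)) <= 3 * t * s ^ 2 ->
  m * (\sum_x \sum_x' \sum_y \sum_y' (c x y == c x' y')) <= 3 * s ^ 2 * t ^ 2 ->
  (i, j) != (i', j') ->
  m * (\sum_(f : {ffun 'I_n -> X}) \sum_(g : {ffun 'I_n -> Y})
        (c (f i) (g j) == c (f i') (g j'))) <= 3 * (s ^ n * t ^ n).
Proof.
move=> cX cY s0 t0 H1 H2 H3; rewrite xpair_eqE negb_and.
have [<- /= jj' | ii' _] := eqVneq i i'.
  have sum_g (f : {ffun 'I_n -> X}) :
      (\sum_(g : {ffun 'I_n -> Y}) (c (f i) (g j) == c (f i) (g j'))) * t ^ 2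
        = t ^ n * \sum_y \sum_y' (c (f i) y == c (f i) y').
    have := sum_ffun2 j j' (fun y y' => c (f i) y == c (f i) y' : nat) jj'.
    by rewrite cY card_ord.
  set S := \sum_f _; have : S * (s * t ^ 2)
      = s ^ n * t ^ n * (\sum_x \sum_y \sum_y' (c x y == c x y')).
    rewrite [s * _]mulnC mulnA big_distrl /= (eq_bigr _ (fun f _ => sum_g f)).
    rewrite -big_distrr /= -mulnA.
    have := sum_ffun1 i (fun x => \sum_y \sum_y' (c x y == c x y')).
    by rewrite cX card_ord => ->; rewrite mulnCA mulnA.
  set A := \sum_x _ in H1 * => E.
  rewrite -(@leq_pmul2r (s * t ^ 2)) ?muln_gt0 ?expn_gt0 ?s0 ?t0 //.
  by rewrite -mulnA E; have := leq_mul (leqnn (s ^ n * t ^ n)) H1; lia.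
have [<- /= | jj'] := eqVneq j j'.
  have sum_f (g : {ffun 'I_n -> Y}) :
      (\sum_(f : {ffun 'I_n -> X}) (c (f i) (g j) == c (f i') (g j))) * s ^ 2
        = s ^ n * \sum_x \sum_x' (c x (g j) == c x' (g j)).
    have := sum_ffun2 i i' (fun x x' => c x (g j) == c x' (g j) : nat) ii'.
    by rewrite cX card_ord.
  rewrite exchange_big /=; set S := \sum_g _; have : S * (t * s ^ 2)
      = s ^ n * t ^ n * (\sum_y \sum_x \sum_x' (c x y == c x' y)).
    rewrite [t * _]mulnC mulnA big_distrl /= (eq_bigr _ (fun g _ => sum_f g)).
    rewrite -big_distrr /= -mulnA.
    have := sum_ffun1 j (fun y => \sum_x \sum_x' (c x y == c x' y)).
    by rewrite cY card_ord => ->; rewrite mulnA.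
  set A := \sum_y _ in H2 * => E.
  rewrite -(@leq_pmul2r (t * s ^ 2)) ?muln_gt0 ?expn_gt0 ?s0 ?t0 //.
  by rewrite -mulnA E; have := leq_mul (leqnn (s ^ n * t ^ n)) H2; lia.
have sum_g (f : {ffun 'I_n -> X}) :
    (\sum_(g : {ffun 'I_n -> Y}) (c (f i) (g j) == c (f i') (g j'))) * t ^ 2
      = t ^ n * \sum_y \sum_y' (c (f i) y == c (f i') y').
  have := sum_ffun2 j j' (fun y y' => c (f i) y == c (f i') y' : nat) jj'.
  by rewrite cY card_ord.
set S := \sum_f _; have : S * (s ^ 2 * t ^ 2)
    = s ^ n * t ^ n * (\sum_x \sum_x' \sum_y \sum_y' (c x y == c x' y')).
  rewrite [s ^ 2 * _]mulnC mulnA big_distrl /= (eq_bigr _ (fun f _ => sum_g f)).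
  rewrite -big_distrr /= -mulnA.
  have := sum_ffun2 i i' (fun x x' => \sum_y \sum_y' (c x y == c x' y')) ii'.
  by rewrite cX card_ord => ->; rewrite mulnCA mulnA.
set A := \sum_x _ in H3 * => E.
rewrite -(@leq_pmul2r (s ^ 2 * t ^ 2)) ?muln_gt0 ?expn_gt0 ?s0 ?t0 //.
by rewrite -mulnA E; have := leq_mul (leqnn (s ^ n * t ^ n)) H3; lia.
Qed.

(** Union bound: at most [n ^ 4] pairs of index pairs, each colliding with probability at most
    [3 / m], where [m = 4 * n ^ 4]; the total is below 1. *)
Lemma rainbow_of_few_star_mono {X Y : finType} {C : eqType} (c : X -> Y -> C)
    (m n q r s t : nat) :
  0 < n -> m = 4 * n ^ 4 -> 0 < q -> #|X| = s -> #|Y| = t ->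
  m * (2 * m) ^ r * q ^ 2 <= s -> m * (2 * m) ^ r * q ^ 2 <= t ->
  (forall R : {set Y}, #|R| = r -> #|[set x | star_mono c x R]| <= q ^ 2) ->
  (forall R : {set X}, #|R| = r ->
     #|[set y | star_mono (fun y x => c x y) y R]| <= q ^ 2) ->
  exists (Q : {set X}) (R : {set Y}), [/\ #|Q| = n, #|R| = n & rainbow c Q R].
Proof.
move=> n0 mE q0 cX cY ms mt fewX fewY.
have m0 : 0 < m by rewrite mE muln_gt0 expn_gt0 n0.
have M0 : 0 < m * (2 * m) ^ r * q ^ 2.
  by rewrite !muln_gt0 !expn_gt0 muln_gt0 m0 q0.
have s0 : 0 < s by lia.
have t0 : 0 < t by lia.
pose coll (p p' : 'I_n * 'I_n) (f : {ffun 'I_n -> X}) (g : {ffun 'I_n -> Y}) :=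
  c (f p.1) (g p.2) == c (f p'.1) (g p'.2).
have [[f [g fg]] | bad] : (exists f g, forall p p', p != p' -> ~~ coll p p' f g)
    \/ forall f g, exists p p', (p != p') && coll p p' f g.
  have [/existsP[f /existsP[g /forallP fg]] | /existsPn bad] := boolP
    [exists f, exists g, forall p, forall p', (p != p') ==> ~~ coll p p' f g].
    left; exists f, g => p p' pp'.
    by have /forallP/(_ p') := fg p; rewrite pp'.
  right=> f g; have /existsPn/(_ g) := bad f.
  case/forallPn=> p /forallPn[p']; rewrite negb_imply negbK => ?.
  by exists p, p'.
  have fgI p p' : c (f p.1) (g p.2) = c (f p'.1) (g p'.2) -> p = p'.
    by move=> e; apply/eqP; apply/negPn/negP => /fg; rewrite /coll e eqxx.
  (* If [f i = f i'], the edges at [(i, o)] and [(i', o)] share a colour, so [i = i']; likewise for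
     [g]. *)
  pose o := Ordinal n0.
  exists (f @: 'I_n), (g @: 'I_n); split.
  - rewrite card_imset ?card_ord // => i i' e.
    by have /= := fgI (i, o) (i', o); rewrite e => /(_ erefl)[].
  - rewrite card_imset ?card_ord // => j j' e.
    by have /= := fgI (o, j) (o, j'); rewrite e => /(_ erefl)[].
  move=> [x y] [x' y'] /setXP[/= /imsetP[i _ ->] /imsetP[j _ ->]].
  move=> /setXP[/= /imsetP[i' _ ->] /imsetP[j' _ ->]] e.
  by have [-> ->] := fgI (i, j) (i', j') e.
exfalso; set N := s ^ n * t ^ n.
have N0 : 0 < N by rewrite muln_gt0 !expn_gt0 s0 t0.
(* [N] counts the pairs of maps, each of which now has a collision. *)
have lower : N <= \sum_f \sum_g \sum_p \sum_(p' | p != p') coll p p' f g.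
  rewrite /N -cX -cY -[n in #|X| ^ n]card_ord -[n in _ * #|Y| ^ n]card_ord.
  rewrite -!card_ffun -sum_nat_const; apply: leq_sum => f _.
  rewrite -sum1_card; apply: leq_sum => g _.
  have [p [p' /andP[pp' cpp']]] := bad f g.
  by rewrite (bigD1 p) //= (bigD1 p') //= cpp'.
have upper : m * (\sum_f \sum_g \sum_p \sum_(p' | p != p') coll p p' f g)
    <= n ^ 4 * (3 * N).
  under eq_bigr => f _ do rewrite exchange_big /=.
  rewrite exchange_big /= big_distrr /=.
  have -> : n ^ 4 * (3 * N) = \sum_(p : 'I_n * 'I_n) n ^ 2 * (3 * N).
    by rewrite sum_nat_const card_prod card_ord mulnn [in RHS]mulnA -expnD.
  apply: leq_sum => p _.
  under eq_bigr => f _ do rewrite exchange_big /=.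
  rewrite exchange_big /= big_distrr /=.
  have -> : n ^ 2 * (3 * N) = \sum_(p : 'I_n * 'I_n) 3 * N.
    by rewrite sum_nat_const card_prod card_ord mulnn.
  rewrite big_mkcond; apply: leq_sum => p' _; case: ifP => //.
  case: p p' => [i j] [i' j'] ij.
  apply: collision_rare => //.
  - exact: (star_collisions _ _ _ _ _ _ _ _ _ cX cY m0 q0 fewX ms mt).
  - exact: (star_collisions _ _ _ _ _ _ _ _ _ cY cX m0 q0 fewY mt ms).
  - exact: (edge_collisions _ _ _ _ _ _ _ _ _ cX cY m0 q0 fewX ms mt).
(* The two bounds give [4 * n ^ 4 * N <= 3 * n ^ 4 * N], absurd for positive [N]. *)
have := leq_trans (leq_mul (leqnn m) lower) upper.
have : 0 < n ^ 4 * N by rewrite muln_gt0 N0 expn_gt0 n0.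
by rewrite mE; lia.
Qed.

(** * The size of [q] against [t] *)

Local Open Scope ring_scope.

(** For [u] the fourth root of [s], [q <= 2 * u] and [log2 s < 4 * u / ln 2]. So
    [M * q ^ 2 * log2 s] is at most a constant times [u ^ 3], below [u ^ 4 = s] for large [u]. *)
Lemma exp_quarter_small {K : realType} (M : nat) :
  exists2 s0 : K, 0 < s0 & forall s t : nat,
    s0 < s%:R -> s%:R / log2 (s%:R : K) < t%:R ->
    exists q : nat, [/\ (0 < q)%N, q%:Z = Num.ceil ((s%:R : K) `^ 4^-1) &
      (M * q ^ 2 <= t)%N].
Proof.
have ln2 : 0 < ln (2 : K) by rewrite ln_gt0 // ltr1n.
(* The first term is the constant in front of [u ^ 3]; the added 1 forces [u > 1], needed for
   [q <= 2 * u] and a positive logarithm. *)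
pose B : K := 16 * M%:R / ln 2 + 1.
have B1 : 1 <= B.
  by rewrite /B lerDr divr_ge0 ?(ltW ln2) // mulr_ge0 ?ler0n.
have B0 : 0 < B by exact: lt_le_trans B1.
exists (B ^+ 4) => [|s t sB st]; first by rewrite exprn_gt0.
set S : K := s%:R in sB st *.
have S0 : 0 < S by apply: lt_trans sB; rewrite exprn_gt0.
set u := S `^ 4^-1.
have u0 : 0 < u by rewrite powR_gt0.
have u4 : u ^+ 4 = S.
  by rewrite -powR_mulrn ?ltW // -powRrM mulVf ?pnatr_eq0 // powRr1 ?ltW.
have uB : B < u by rewrite -(@ltr_pXn2r _ 4) ?nnegrE ?ltW // u4.
have u1 : 1 < u by exact: le_lt_trans uB.
have qE : (`|Num.ceil u|%N)%:Z = Num.ceil u by rewrite gez0_abs // ceil_ge0; lra.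
exists `|Num.ceil u|%N; rewrite -/u; split=> //.
  by rewrite -ltz_nat qE ceil_gt_int /=; lra.
set q := `|Num.ceil u|%N in qE *.
have q2u : q%:R <= 2 * u :> K.
  have -> : q%:R = (Num.ceil u)%:~R :> K by rewrite -qE.
  by have := ceilB1_lt u; rewrite intrB; lra.
have lnS : log2 S < 4 * u / ln 2.
  rewrite /log2 ltr_pM2r ?invr_gt0 // -u4 lnXn // -[ln u *+ 4]mulr_natl ltr_pM2l //.
  by apply: ln_sublinear.
have log0 : 0 < log2 S.
  by rewrite divr_gt0 // -u4 ln_gt0 // exprn_egt1 // ltW.
rewrite -(ler_nat K) natrM natrX; apply: le_trans (ltW st).
rewrite ler_pdivlMr //.
have M0 : 0 <= M%:R :> K by exact: ler0n.
apply: (@le_trans _ _ (M%:R * (2 * u) ^+ 2 * (4 * u / ln 2))).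
  apply: ler_pM; rewrite ?(ltW lnS) ?(ltW log0) ?mulr_ge0 ?exprn_ge0 //.
  by rewrite ler_wpM2l // ler_pXn2r ?nnegrE ?ler0n // mulr_ge0 // ltW.
have -> : M%:R * (2 * u) ^+ 2 * (4 * u / ln 2) = (16 * M%:R / ln 2) * u ^+ 3.
  by field; rewrite gt_eqF.
rewrite -u4 [u ^+ 4]exprS ler_pM2r ?exprn_gt0 // ltW //.
by apply: le_lt_trans uB; rewrite /B lerDl.
Qed.

(** * Assembling the three outcomes *)

Theorem theorem6p4 (K : realType) (l : nat) (hl : (2 <= l)%N) :
  exists (eps s0 : K), 0 < eps /\ 0 < s0 /\
  forall (X Y : finType) (C : Type) (c : X -> Y -> C) (s t : nat),
    #|X| = s -> #|Y| = t ->
    s0 < s%:R -> s%:R / log2 (s%:R : K) < t%:R -> (t <= s)%N ->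
    (exists (Q : {set X}) (R : {set Y}),
        #|Q| = (4 * l)%N /\ #|R| = (4 * l)%N /\ rainbow c Q R)
    \/
    ((exists (Q : {set X}) (R : {set Y}),
        #|Q|%:Z = Num.ceil ((s%:R : K) `^ eps) /\ #|R| = (2 * l)%N /\
        canonical_coloring c Q R)
     \/
     (exists (Q : {set Y}) (R : {set X}),
        #|Q|%:Z = Num.ceil ((s%:R : K) `^ eps) /\ #|R| = (2 * l)%N /\
        canonical_coloring (fun y x => c x y) Q R))
    \/
    ((exists (Q : {set X}) (R : {set Y}),
        #|Q|%:Z = Num.ceil ((s%:R : K) `^ eps) /\ #|R| = (2 * l)%N /\
        monochromatic c Q R)
     \/
     (exists (Q : {set Y}) (R : {set X}),
        #|Q|%:Z = Num.ceil ((s%:R : K) `^ eps) /\ #|R| = (2 * l)%N /\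
        monochromatic (fun y x => c x y) Q R)).
Proof.
pose n := (4 * l)%N; pose m := (4 * n ^ 4)%N; pose r := (2 * l)%N.
have n0 : (0 < n)%N by rewrite /n; lia.
have r0 : (0 < r)%N by rewrite /r; lia.
(* This factor depends only on [l] and is the one in the size hypotheses of
   [rainbow_of_few_star_mono]. *)
have [s0 s0_gt0 Hs0] := @exp_quarter_small K (m * (2 * m) ^ r).
exists 4^-1, s0; split; first by rewrite invr_gt0.
split=> // X Y C c s t cX cY ss0 st ts.
have [q [q0 <- Mt]] := Hs0 _ _ ss0 st.
(* Colours need decidable equality, which [C] lacks. *)
pose c' : X -> Y -> {classic C} := c.
have [/existsP[R /andP[/eqP Rr qR]] | /existsPn fewX] := boolP
    [exists R : {set Y}, (#|R| == r) && (q ^ 2 <= #|[set x | star_mono c' x R]|)%N].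
  have [|Q [Qq [cQ | mQ]]] := canonical_or_monochromatic c' q R q0 _ qR.
  - by rewrite Rr.
  - by right; left; left; exists Q, R; rewrite Qq.
  - by right; right; left; exists Q, R; rewrite Qq.
pose d' y x := c' x y.
have [/existsP[R /andP[/eqP Rr qR]] | /existsPn fewY] := boolP
    [exists R : {set X}, (#|R| == r) && (q ^ 2 <= #|[set y | star_mono d' y R]|)%N].
  have [|Q [Qq [cQ | mQ]]] := canonical_or_monochromatic d' q R q0 _ qR.
  - by rewrite Rr.
  - by right; left; right; exists Q, R; rewrite Qq.
  - by right; right; right; exists Q, R; rewrite Qq.
(* Both sides now have fewer than [q ^ 2] one-coloured stars on each [r]-set; the size bound for [t]
   passes to [s] by [t <= s]. *)
left; have [||Q [R [Qn Rn QR]]] :=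
  rainbow_of_few_star_mono c' m n q r s t n0 erefl q0 cX cY (leq_trans Mt ts) Mt.
- by move=> R Rr; have := fewX R; rewrite Rr eqxx -ltnNge => /ltnW.
- by move=> R Rr; have := fewY R; rewrite Rr eqxx -ltnNge => /ltnW.
by exists Q, R.
Qed.
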